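(* Let $G$ be a finitely generated partially commutative group with canonical generating set $X$. Then $\mathrm{cdim}(G)$ equals the height of the lattice $\mathfrak{C}(X;G)$ of canonical centralisers, i.e. $\mathrm{cdim}(G)$ is the largest integer $k$ for which there exist subsets $Y_0,Y_1,\dots,Y_k\subseteq X$ with $C(Y_0)>C(Y_1)>\cdots>C(Y_k)$.
   Context: Let $\Gamma$ be a finite simple undirected graph with vertex set $X$, and let $G=G(\Gamma)=\langle X\mid [x,y]=1 \text{ whenever } x,y \text{ are joined by an edge of }\Gamma\rangle$ be the (free) partially commutative group with commutation graph $\Gamma$. For $S\subseteq G$, $C(S)$ is the centraliser of $S$ in $G$; a centraliser is a subgroup of the form $C(S)$, and a canonical centraliser is one of the form $C(Y)$ with $Y\subseteq X$; $\mathfrak{C}(X;G)$ is the set of canonical centralisers ordered by inclusion. A centraliser chain of length $k$ is a sequence of centralisers $C_0>C_1>\cdots>C_k$ with strict inclusions. The centraliser dimension $\mathrm{cdim}(G)$ of a group $G$ is the maximal length of a centraliser chain in $G$ (and $\infty$ if there is no maximum); for partially commutative groups it is finite. *)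

(* Defs.v *)
From Stdlib Require Import Relations.
From mathcomp Require Import all_boot.
Set Implicit Arguments. Unset Strict Implicit. Unset Printing Implicit Defensive.

(* Partially commutative group G(Gamma), Gamma = (X, e) a finite simple graph
   (X : finType, e symmetric irreflexive).  G is given by its presentation:
   elements are words over X^{+-1} (letter (x, false) = x, (x, true) = x^-1),
   modulo the congruence generated by free cancellation and by the commutation
   of letters whose underlying generators are joined by an edge.  *)

Section PCGroup.
Variables (X : finType) (e : rel X).

Definition letter := (X * bool)%type.
Definition word := seq letter.

Definition inv_letter (a : letter) : letter := (a.1, ~~ a.2).

Inductive pc_step : word -> word -> Prop :=
| pc_cancel (u v : word) (a : letter) :
    pc_step (u ++ [:: a; inv_letter a] ++ v) (u ++ v)
| pc_comm (u v : word) (a b : letter) :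
    e a.1 b.1 -> pc_step (u ++ [:: a; b] ++ v) (u ++ [:: b; a] ++ v).

Definition pc_eq : word -> word -> Prop := clos_refl_sym_trans word pc_step.

(* product in G is concatenation; the subset S of G is a predicate on words *)
Definition centraliser (S : word -> Prop) : word -> Prop :=
  fun g => forall s, S s -> pc_eq (g ++ s) (s ++ g).

(* strict inclusion A < B of (equivalence-saturated) subsets of G *)
Definition strict_sub (A B : word -> Prop) : Prop :=
  (forall g, A g -> B g) /\ exists g, B g /\ ~ A g.

Definition centraliser_chain (k : nat) : Prop :=
  exists S : nat -> (word -> Prop),
    forall i, i < k -> strict_sub (centraliser (S i.+1)) (centraliser (S i)).

Definition gens_of (Y : {set X}) : word -> Prop :=
  fun w => exists2 y, y \in Y & w = [:: (y, false)].

Definition canonical_chain (k : nat) : Prop :=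
  exists Y : nat -> {set X},
    forall i, i < k ->
      strict_sub (centraliser (gens_of (Y i.+1))) (centraliser (gens_of (Y i))).

Definition cdim_is (n : nat) : Prop :=
  centraliser_chain n /\ forall m, centraliser_chain m -> m <= n.

Definition canonical_height_is (n : nat) : Prop :=
  canonical_chain n /\ forall m, canonical_chain m -> m <= n.

End PCGroup.

(* Main.v *)
(* A centraliser chain of length [k] amounts to elements [g_i], [s_i], [i < k], such that [g_i]
   commutes with [s_j] for [j < i] but not with [s_i]; canonical chains are the case where
   [g_i] and [s_i] are generators. Centralise the [s_i] one at a time: the elements [g] that
   remain are, up to a common conjugation, such that [C(g)] is the intersection of [C(u)], with
   [u] in [G(A)] for a subset [A] of [X], and of some of [r] fixed centralisers [D_1, ...,
   D_r]. If the next [s] centralises [G(A)], one of the [D_l] is lost. If not, minimal double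
   coset representatives and the structure of the centraliser of a cyclically reduced element
   replace [A] by a smaller set, with at most one new [D_l]; one new [D_l] costs at least 2 in
   the height of [A], as its support contains two generators that do not commute. So [r] plus
   the height of [A] drops at each step.

   Centralisers are computed in free monoids: two reduced words are equal in [G] iff their
   projections to all pairs of non-commuting generators agree, and if [g] commutes with a
   cyclically reduced [c], then [c ^ n g] commutes with [c] without any cancellation for some
   [n]. *)
Require Import Defs.
From Stdlib Require Import Relations Setoid Morphisms Classical.
From mathcomp Require Import all_boot zify.
Set Implicit Arguments. Unset Strict Implicit. Unset Printing Implicit Defensive.

(** * Commuting words in a free monoid *)

Section FreeMonoid.
Variable T : eqType.
Implicit Types (u v w h : seq T) (p q n : nat).

Definition pw (w : seq T) (n : nat) := flatten (nseq n w).

Lemma pwS w n : pw w n.+1 = w ++ pw w n. Proof. by []. Qed.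

Lemma pwD w m n : pw w (m + n) = pw w m ++ pw w n.
Proof. by rewrite /pw nseqD flatten_cat. Qed.

Lemma pwSr w n : pw w n.+1 = pw w n ++ w.
Proof. by rewrite -addn1 pwD /pw /= cats0. Qed.

Lemma pwM w m n : pw (pw w m) n = pw w (n * m).
Proof. by elim: n => // n IH; rewrite pwS IH mulSn pwD. Qed.

Lemma size_pw w n : size (pw w n) = n * size w.
Proof. by elim: n => // n IH; rewrite pwS size_cat IH mulSn. Qed.

Lemma filter_pw (a : pred T) w n : filter a (pw w n) = pw (filter a w) n.
Proof. by elim: n => // n IH; rewrite !pwS filter_cat IH. Qed.

Lemma cat_pw_comm u v n : u ++ v = v ++ u -> pw u n ++ v = v ++ pw u n.
Proof.
move=> uv; elim: n => [|n IH]; first by rewrite cats0.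
by rewrite pwS -catA IH catA uv catA.
Qed.

(** The two powers commute and have the same length, so each is the prefix of that length of one and
    the same word. *)
Lemma cat_comm_pw_eq u v p q :
  u ++ v = v ++ u -> p * size u = q * size v -> pw u p = pw v q.
Proof.
move=> uv sz; have /eqP : pw u p ++ pw v q = pw v q ++ pw u p.
  by apply: cat_pw_comm; symmetry; apply: cat_pw_comm; symmetry.
by rewrite eqseq_cat ?size_pw // => /andP[/eqP].
Qed.

Lemma pw_inj u v n : size u = size v -> 0 < n -> pw u n = pw v n -> u = v.
Proof.
by case: n => // n sz _ /eqP; rewrite !pwS eqseq_cat // => /andP[/eqP].
Qed.

(* [h w] and [w h] have the same length and both commute with [w ^ p], so they have equal powers. *)
Lemma cat_comm_root h w p :
  0 < p -> h ++ pw w p = pw w p ++ h -> h ++ w = w ++ h.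
Proof.
move=> p0 hw; have [->|w0] := eqVneq w [::]; first by rewrite cats0.
have szw : 0 < size w by rewrite lt0n size_eq0.
have wwp : w ++ pw w p = pw w p ++ w by rewrite -pwS pwSr.
apply: (@pw_inj _ _ (p * size w)); rewrite ?size_cat 1?addnC ?muln_gt0 ?p0 //.
rewrite (@cat_comm_pw_eq (h ++ w) (pw w p) (p * size w) (size h + size w)).
- apply: cat_comm_pw_eq; first by rewrite catA -wwp -!catA hw.
  rewrite size_cat size_pw; lia.
- by rewrite -catA wwp !catA hw.
- by rewrite size_cat size_pw; lia.
Qed.

Lemma cat_comm_mem h w :
  h ++ w = w ++ h -> w != [::] -> {subset h <= w}.
Proof.
move=> hw w0 a ah; have : a \in pw h (size w).
  case: w w0 {hw} => //= b w _.
  by rewrite pwS mem_cat ah.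
rewrite (@cat_comm_pw_eq h w _ (size h)) //; last by rewrite mulnC.
by move=> /flattenP[s /nseqP[->]].
Qed.

End FreeMonoid.

Section PC.
Variables (X : finType) (e : rel X).
Hypotheses (e_sym : symmetric e) (e_irr : irreflexive e).

Local Notation W := (word X).
Local Notation "u =G v" := (pc_eq e u v) (at level 70).
Implicit Types (a b : letter X) (u v w s t g h c p q : W) (x y z : X) (A B : {set X}).

(** * Group laws on words *)

Lemma inv_letterK : involutive (@inv_letter X).
Proof. by case=> x b; rewrite /inv_letter /= negbK. Qed.

Lemma inv_letter_neq a : inv_letter a != a.
Proof. by case: a => x [] ; rewrite /inv_letter xpair_eqE /= andbF. Qed.

Global Instance pc_eq_equiv : Equivalence (pc_eq e).
Proof.
split; first by move=> u; apply: rst_refl.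
- by move=> u v; apply: rst_sym.
- by move=> u v w; apply: rst_trans.
Qed.

Lemma pc_eq_ctx u v p q : u =G v -> p ++ u ++ q =G p ++ v ++ q.
Proof.
elim=> {u v} [_ _ []|u|u v _ IH|u v w _ IH1 _ IH2].
- move=> u v a; apply: rst_step.
  by have := @pc_cancel _ e (p ++ u) (v ++ q) a; rewrite -!catA.
- move=> u v a b eab; apply: rst_step.
  by have := @pc_comm _ e (p ++ u) (v ++ q) a b eab; rewrite -!catA.
- reflexivity.
- by symmetry.
- by transitivity (p ++ v ++ q).
Qed.

Global Instance cat_proper : Proper (pc_eq e ==> pc_eq e ==> pc_eq e) (@cat (letter X)).
Proof.
move=> u u' uu' v v' vv'; transitivity (u ++ v').
  by have := pc_eq_ctx u [::] vv'; rewrite !cats0.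
exact: (pc_eq_ctx [::] v' uu').
Qed.

Lemma pc_eq_cancel a : [:: a; inv_letter a] =G [::].
Proof. exact/rst_step/(pc_cancel e [::] [::]). Qed.

Lemma pc_eq_comm a b : e a.1 b.1 -> [:: a; b] =G [:: b; a].
Proof. by move=> eab; apply/rst_step/(pc_comm [::] [::]). Qed.

Lemma pc_eq_cons_all a v : all (fun b => e a.1 b.1) v -> a :: v =G v ++ [:: a].
Proof.
elim: v => [|b v IH] /=; first by reflexivity.
case/andP=> eab /IH av.
change ([:: a; b] ++ v =G [:: b] ++ (v ++ [:: a])).
rewrite -av pc_eq_comm //; reflexivity.
Qed.

Definition winv w : W := rev (map (@inv_letter X) w).

Lemma winvK : involutive winv.
Proof.
by move=> w; rewrite /winv map_rev revK -map_comp map_id_in // => a _ /=; rewrite inv_letterK.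
Qed.

Lemma mulwV w : w ++ winv w =G [::].
Proof.
elim: w => [|a w IH]; first by reflexivity.
rewrite /winv /= rev_cons -cats1 catA -/(winv w).
change ([:: a] ++ (w ++ winv w) ++ [:: inv_letter a] =G [::]).
rewrite IH; exact: pc_eq_cancel.
Qed.

Lemma mulVw w : winv w ++ w =G [::].
Proof. by have := mulwV (winv w); rewrite winvK. Qed.

Lemma mulKw p w : winv p ++ p ++ w =G w.
Proof. by rewrite catA mulVw; reflexivity. Qed.

Lemma mulVKw p w : p ++ winv p ++ w =G w.
Proof. by rewrite catA mulwV; reflexivity. Qed.

Lemma mulw_inj p u v : p ++ u =G p ++ v -> u =G v.
Proof. by move=> puv; rewrite -(mulKw p u) puv mulKw; reflexivity. Qed.

Lemma size_winv w : size (winv w) = size w.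
Proof. by rewrite /winv size_rev size_map. Qed.

(** * Projections, cancellation and normal forms *)

Definition proj x y w : W := [seq a <- w | (a.1 == x) || (a.1 == y)].
Arguments proj : simpl never.

(** Trace equivalence: equality in the partially commutative monoid on signed letters, without
    cancellation. The pairs [x = y] are included, as [e] is irreflexive. *)
Definition teq u v := forall x y, ~~ e x y -> proj x y u = proj x y v.

Lemma projC x y w : proj x y w = proj y x w.
Proof. by apply: eq_filter => a; rewrite orbC. Qed.

Lemma proj_cat x y u v : proj x y (u ++ v) = proj x y u ++ proj x y v.
Proof. exact: filter_cat. Qed.

Lemma proj_cons x y a v :
  proj x y (a :: v) = if (a.1 == x) || (a.1 == y) then a :: proj x y v else proj x y v.
Proof. by []. Qed.

Lemma proj_comm0 x y a v : ~~ e x y -> (a.1 == x) || (a.1 == y) ->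
  all (fun b => e a.1 b.1) v -> proj x y v = [::].
Proof.
move=> exy axy av; apply/eqP; rewrite -(negbK (_ == _)) -has_filter; apply/hasPn => b bv.
have eab := allP av b bv; apply/negP => bxy; move: eab.
case/orP: axy => /eqP ->; case/orP: bxy => /eqP ->; rewrite ?e_irr ?(negbTE exy) //.
by rewrite e_sym (negbTE exy).
Qed.

(** Says that [inv_letter a] can be moved to the front of [w] by commutations. Phrased through
    projections, it is visibly invariant under [teq]. *)
Definition cancels a w :=
  [forall y, ~~ e a.1 y ==> (ohead (proj a.1 y w) == Some (inv_letter a))].

Lemma cancelsP a w : reflect
  (forall y, ~~ e a.1 y -> ohead (proj a.1 y w) = Some (inv_letter a)) (cancels a w).
Proof.
apply: (iffP forallP) => H y; first by move/(implyP (H y))/eqP.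
by apply/implyP => /H ->.
Qed.

Lemma cancels_cons_comm a b w : e a.1 b.1 -> cancels a (b :: w) = cancels a w.
Proof.
move=> eab; apply: eq_forallb => y; case: (boolP (e a.1 y)) => //= ay.
rewrite proj_cons; case: ifP => // /orP[] /eqP E; move: eab; rewrite E ?e_irr //.
by rewrite (negbTE ay).
Qed.

Lemma cancels_split a w : cancels a w ->
  exists v1 v2, w = v1 ++ inv_letter a :: v2 /\ all (fun b => e a.1 b.1) v1.
Proof.
elim: w => [/cancelsP/(_ a.1)|b w IH]; first by rewrite e_irr => /(_ isT).
case: (boolP (e a.1 b.1)) => eab.
  rewrite cancels_cons_comm // => /IH[v1 [v2 [-> av]]].
  by exists (b :: v1), v2; rewrite /= eab.
move=> /cancelsP/(_ b.1 eab); rewrite proj_cons eqxx orbT /= => -[->].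
by exists [::], w.
Qed.

Lemma cancels_cat a v1 v2 : all (fun b => e a.1 b.1) v1 ->
  cancels a (v1 ++ inv_letter a :: v2).
Proof.
move=> av; apply/cancelsP => y ay.
by rewrite proj_cat (@proj_comm0 _ _ a v1) ?eqxx // proj_cons /= eqxx.
Qed.

(** The action of a letter on reduced words, for van der Waerden's proof of the normal form. *)
Definition mul a w : W := if cancels a w then rem (inv_letter a) w else a :: w.

Lemma rem_comm a v1 v2 : all (fun b => e a.1 b.1) v1 ->
  rem (inv_letter a) (v1 ++ inv_letter a :: v2) = v1 ++ v2.
Proof.
elim: v1 => [|b v1 IH] /=; first by rewrite eqxx.
case/andP=> eab /IH ->; case: eqP => // E.
by move: eab; rewrite E /= e_irr.
Qed.

(** A cancelled letter stands first in every projection that sees it, so the projections of the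
    result depend only on those of [w]. *)
Lemma proj_mul x y a w : ~~ e x y -> proj x y (mul a w) =
  if (a.1 == x) || (a.1 == y)
  then if cancels a w then behead (proj x y w) else a :: proj x y w
  else proj x y w.
Proof.
rewrite /mul => exy; case: (boolP (cancels a w)) => [ca|_]; last exact: proj_cons.
have [v1 [v2 [-> av]]] := cancels_split ca.
rewrite rem_comm // !proj_cat proj_cons /=.
by case: ifP => axy; rewrite axy // (@proj_comm0 x y a v1 exy axy av).
Qed.

Lemma cancels_teq a u v : teq u v -> cancels a u = cancels a v.
Proof.
move=> uv; apply: eq_forallb => y; case: (boolP (e a.1 y)) => //= ay.
by rewrite uv.
Qed.

Lemma mul_teq a u v : teq u v -> teq (mul a u) (mul a v).
Proof.
by move=> uv x y exy; rewrite !proj_mul // (cancels_teq _ uv) !uv.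
Qed.

Lemma teq_sym u v : teq u v -> teq v u.
Proof. by move=> uv x y exy; rewrite uv. Qed.

Lemma teq_trans u v w : teq u v -> teq v w -> teq u w.
Proof. by move=> uv vw x y exy; rewrite uv ?vw. Qed.

Lemma cancels_mul a b w : e a.1 b.1 -> cancels a (mul b w) = cancels a w.
Proof.
move=> eab; apply: eq_forallb => y; case: (boolP (e a.1 y)) => //= ay.
rewrite proj_mul //; case: ifP => // /orP[] /eqP E; move: eab; rewrite E ?e_irr //.
by rewrite (negbTE ay).
Qed.

Lemma mul_comm a b w : e a.1 b.1 -> teq (mul a (mul b w)) (mul b (mul a w)).
Proof.
move=> eab x y exy; have eba : e b.1 a.1 by rewrite e_sym.
rewrite !proj_mul // !cancels_mul //.
case: (boolP ((a.1 == x) || (a.1 == y))) => // ax; case: (boolP ((b.1 == x) || (b.1 == y))) => // bx.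
exfalso; move: eab exy.
by case/orP: ax => /eqP->; case/orP: bx => /eqP-> ; rewrite ?e_irr // ?(e_sym y) => ->.
Qed.

Fixpoint reduced w := if w is a :: w' then ~~ cancels a w' && reduced w' else true.

Lemma reduced_rem a w : cancels a w -> reduced w -> reduced (rem (inv_letter a) w).
Proof.
elim: w => //= b w IH ca /andP[nb rw]; case: eqP => // bneq.
have eab : e a.1 b.1.
  apply/negPn/negP => eab; move/cancelsP/(_ b.1 eab): ca.
  by rewrite proj_cons eqxx orbT /= => -[].
move: ca; rewrite cancels_cons_comm // => ca /=; rewrite IH // andbT.
by have := @cancels_mul b a w; rewrite /mul ca e_sym => ->.
Qed.

Lemma reduced_mul a w : reduced w -> reduced (mul a w).
Proof.
by rewrite /mul; case: ifP => [|ca] /=; [exact: reduced_rem | rewrite ca].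
Qed.

Lemma not_cancels_rem a w : cancels (inv_letter a) w -> reduced w -> ~~ cancels a (rem a w).
Proof.
elim: w => [/cancelsP/(_ a.1)|b w IH]; first by rewrite e_irr => /(_ isT).
move=> ca /= /andP[nb rw]; case: eqP => [<- //|bneq].
have eab : e a.1 b.1.
  apply/negPn/negP => eab; move/cancelsP/(_ b.1 eab): ca.
  by rewrite proj_cons eqxx orbT /= inv_letterK => -[].
by move: ca; rewrite !cancels_cons_comm //; move=> /IH; apply.
Qed.

(** Holds only up to [teq]: a letter [a] cancelled inside [w] comes back at the front, where
    reducedness of [w] prevents a second cancellation. *)
Lemma mulK a w : reduced w -> teq (mul a (mul (inv_letter a) w)) w.
Proof.
move=> rw; rewrite {2}/mul inv_letterK; case: ifP => ca; last first.
  by rewrite /mul (@cancels_cat a [::]) //= eqxx.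
rewrite /mul (negbTE (not_cancels_rem ca rw)).
have [v1 [v2 [E av]]] := cancels_split ca; move: E; rewrite inv_letterK => ->.
have := @rem_comm (inv_letter a) v1 v2 av; rewrite inv_letterK => -> x y exy.
rewrite !proj_cat !proj_cons proj_cat; case: ifP => // axy.
by rewrite (@proj_comm0 x y _ v1 exy _ av).
Qed.

Definition nf w := foldr mul [::] w.

Lemma reduced_nf w : reduced (nf w).
Proof. by elim: w => //= a w; apply: reduced_mul. Qed.

Lemma nf_cat_teq u v v' : teq (nf v) (nf v') -> teq (nf (u ++ v)) (nf (u ++ v')).
Proof. by move=> vv'; elim: u => //= a u; apply: mul_teq. Qed.

(** By [mulK] and [mul_comm], the action of the letters respects both kinds of relations up to
    [teq]. *)
Lemma nf_teq u v : u =G v -> teq (nf u) (nf v).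
Proof.
elim=> {u v} [_ _ []|u|u v _ IH|u v w _ IH1 _ IH2] //.
- by move=> u v a; apply: nf_cat_teq => /=; apply/mulK/reduced_nf.
- by move=> u v a b eab; apply: nf_cat_teq; apply: mul_comm.
- exact: teq_sym.
- exact: teq_trans IH1 IH2.
Qed.

Lemma teq_pc_eq u v : teq u v -> u =G v.
Proof.
elim: u v => [|a u IH] v uv.
  case: v uv => [|b v] uv; first by reflexivity.
  by have := uv b.1 b.1; rewrite e_irr proj_cons eqxx /= => /(_ isT).
(* With [inv_letter a] as argument, [cancels] says that [a] itself can be moved to the front. *)
have ca : cancels (inv_letter a) v.
  by rewrite -(cancels_teq _ uv); have := @cancels_cat (inv_letter a) [::] u isT; rewrite inv_letterK.
have [v1 [v2 [E av]]] := cancels_split ca; rewrite inv_letterK /= in E av; subst v.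
have /IH uv12 : teq u (v1 ++ v2).
  move=> x y exy; have := uv x y exy; rewrite !proj_cat !proj_cons; case: ifP => // axy.
  by rewrite (@proj_comm0 x y a v1) //= => -[].
transitivity ([:: a] ++ u); first by reflexivity.
rewrite uv12 -(cat1s a v2) 2!catA.
have := pc_eq_cons_all av; rewrite -cat1s => ->; reflexivity.
Qed.

Lemma mul_pc_eq a w : mul a w =G a :: w.
Proof.
rewrite /mul; case: ifP => [ca|_]; last by reflexivity.
have [v1 [v2 [-> av]]] := cancels_split ca; rewrite rem_comm //.
have ->: a :: v1 ++ inv_letter a :: v2 = (a :: v1) ++ [:: inv_letter a] ++ v2 by [].
rewrite (pc_eq_cons_all av) -catA (catA [:: a]).
have E : [:: a] ++ [:: inv_letter a] =G [::] := pc_eq_cancel a.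
by rewrite E; reflexivity.
Qed.

Lemma nf_pc_eq w : nf w =G w.
Proof.
elim: w => [|a w IH] /=; first by reflexivity.
rewrite mul_pc_eq -cat1s IH; reflexivity.
Qed.

Lemma nf_id w : reduced w -> nf w = w.
Proof. by elim: w => //= a w IH /andP[/negbTE ca /IH ->]; rewrite /mul ca. Qed.

Lemma count_proj a w : count_mem a (proj a.1 a.1 w) = count_mem a w.
Proof.
rewrite /proj count_filter; apply: eq_count => b /=.
by case: eqP => // ->; rewrite eqxx.
Qed.

Lemma teq_size u v : teq u v -> size u = size v.
Proof.
move=> uv; apply: perm_size; apply/allP => a _ /=.
by rewrite -(count_proj a u) -(count_proj a v) uv // e_irr.
Qed.

(** * Length of elements *)

Definition len w := size (nf w).

Lemma len_eq u v : u =G v -> len u = len v.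
Proof. by move=> /nf_teq/teq_size. Qed.

Lemma size_mul a w : size (mul a w) <= (size w).+1.
Proof. by rewrite /mul; case: ifP => // _; rewrite (leq_trans (size_subseq (rem_subseq _ _))). Qed.

Lemma len_le w : len w <= size w.
Proof. by elim: w => //= a w IH; rewrite (leq_trans (size_mul _ _)). Qed.

Lemma reduced_len w : reduced w = (len w == size w).
Proof.
apply/idP/eqP => [/nf_id|]; first by rewrite /len => ->.
elim: w => //= a w IH E.
have sw : len w = size w.
  apply/eqP; rewrite eqn_leq len_le /= -ltnS -{1}E; exact: size_mul.
have rw := IH sw; rewrite rw andbT; move: E; rewrite /len /= (nf_id rw) /mul.
case: ifP => // _ E; have := size_subseq (rem_subseq (inv_letter a) w).
by rewrite E ltnn.
Qed.

Lemma len_min u v : reduced u -> u =G v -> size u <= size v.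
Proof. by rewrite reduced_len => /eqP <- /len_eq ->; apply: len_le. Qed.

(** The length bound forces [v] to be reduced as well, so both words are their own normal forms. *)
Lemma reduced_teq u v : reduced u -> u =G v -> size v <= size u -> teq u v.
Proof.
move=> ru uv vu; have szv : len v = size v.
  apply/eqP; rewrite eqn_leq len_le -(len_eq uv).
  by move: ru; rewrite reduced_len => /eqP ->.
by have := nf_teq uv; rewrite (nf_id ru) (@nf_id v) ?reduced_len ?szv.
Qed.

Lemma len_cat u v : len (u ++ v) <= len u + len v.
Proof.
have -> : len (u ++ v) = len (nf u ++ nf v).
  by apply: len_eq; rewrite !nf_pc_eq; reflexivity.
by rewrite (leq_trans (len_le _)) // size_cat.
Qed.

Lemma len_winv w : len (winv w) <= size w.
Proof. by rewrite -(size_winv w) len_le. Qed.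

(** * Commutation and conjugation *)

Definition comm u v := u ++ v =G v ++ u.

Global Instance comm_proper : Proper (pc_eq e ==> pc_eq e ==> iff) comm.
Proof. by move=> u u' uu' v v' vv'; rewrite /comm uu' vv'. Qed.

Lemma comm_sym u v : comm u v -> comm v u.
Proof. by move=> uv; rewrite /comm uv; reflexivity. Qed.

Lemma comm_refl u : comm u u.
Proof. by rewrite /comm; reflexivity. Qed.

Lemma comm_nil s : comm [::] s.
Proof. by rewrite /comm cats0; reflexivity. Qed.

Lemma comm_cat u v s : comm u s -> comm v s -> comm (u ++ v) s.
Proof.
by rewrite /comm => us vs; rewrite -catA vs catA us -catA; reflexivity.
Qed.

Lemma comm_winv u s : comm u s -> comm (winv u) s.
Proof.
move=> us; apply: (@mulw_inj u); rewrite mulVKw catA us -catA mulwV cats0; reflexivity.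
Qed.

Lemma comm_catK u v s : comm (u ++ v) s -> comm u s -> comm v s.
Proof.
by move=> uvs us; rewrite -(mulKw u v); apply: comm_cat => //; apply: comm_winv.
Qed.

Lemma comm_pw u s n : comm u s -> comm (pw u n) s.
Proof.
by move=> us; elim: n => [|n IH]; [apply: comm_nil | apply: comm_cat].
Qed.

Lemma pw_pc_eq u v n : u =G v -> pw u n =G pw v n.
Proof.
move=> uv; elim: n => [|n IH]; first by reflexivity.
by rewrite !pwS IH uv; reflexivity.
Qed.

Lemma pw_cat u v n : comm u v -> pw (u ++ v) n =G pw u n ++ pw v n.
Proof.
move=> uv; elim: n => [|n IH]; first by reflexivity.
have vu : comm v (pw u n) by apply/comm_sym/comm_pw.
by rewrite !pwS IH -!catA (catA v) vu -!catA; reflexivity.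
Qed.

Lemma winv_cat u v : winv (u ++ v) = winv v ++ winv u.
Proof. by rewrite /winv map_cat rev_cat. Qed.

Definition conj p u : W := p ++ u ++ winv p.

Global Instance conj_proper : Proper (eq ==> pc_eq e ==> pc_eq e) conj.
Proof. by move=> p _ <- u u' uu'; rewrite /conj uu'; reflexivity. Qed.

Lemma conj_conj p q u : conj p (conj q u) = conj (p ++ q) u.
Proof. by rewrite /conj winv_cat -!catA. Qed.

Lemma conj_id p u : comm p u -> conj p u =G u.
Proof. by rewrite /comm /conj catA => ->; rewrite -catA mulwV cats0; reflexivity. Qed.

Lemma conjVK p u : conj (winv p) (conj p u) =G u.
Proof. by rewrite /conj winvK -catA mulKw -catA mulVw cats0; reflexivity. Qed.

Lemma conjKV p u : conj p (conj (winv p) u) =G u.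
Proof. by have := conjVK (winv p) u; rewrite winvK. Qed.

Lemma conj_rot p u : conj (winv p) (p ++ u) =G u ++ p.
Proof. by rewrite /conj winvK -catA mulKw; reflexivity. Qed.

Lemma conj_cat p u v : conj p (u ++ v) =G conj p u ++ conj p v.
Proof. by rewrite /conj -!catA mulKw; reflexivity. Qed.

Lemma conj_pw p u n : pw (conj p u) n =G conj p (pw u n).
Proof.
elim: n => [|n IH]; first by rewrite /conj mulwV; reflexivity.
by rewrite !pwS conj_cat IH; reflexivity.
Qed.

Lemma conj_comm p u v : comm u v -> comm (conj p u) (conj p v).
Proof. by rewrite /comm -!conj_cat => ->; reflexivity. Qed.

Lemma comm_conj p u s : comm (conj p u) s <-> comm u (conj (winv p) s).
Proof.
split=> [/(conj_comm (winv p))|/(conj_comm p)]; first by rewrite conjVK.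
by rewrite conjKV.
Qed.

Lemma comm_letters u v :
  (forall a b, a \in u -> b \in v -> comm [:: a] [:: b]) -> comm u v.
Proof.
elim: u => [|a u IH] H; first exact: comm_nil.
have {}IH := IH (fun _ _ ha => H _ _ (mem_behead (s := a :: u) ha)).
apply: (@comm_cat [:: a]) => // {IH}.
elim: v H => [|b v IH] H; first by apply/comm_sym/comm_nil.
apply/comm_sym/(@comm_cat [:: b]); apply/comm_sym; first by apply: H; rewrite mem_head.
by apply: IH => a' b' ha hb; apply: H => //; rewrite in_cons hb orbT.
Qed.

Definition adj x y := (x == y) || e x y.

Lemma adj_sym x y : adj x y = adj y x.
Proof. by rewrite /adj eq_sym e_sym. Qed.

Lemma comm_adj u v : (forall a b, a \in u -> b \in v -> adj a.1 b.1) -> comm u v.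
Proof.
move=> H; apply: comm_letters => a b /H{}H /H/orP[/eqP|]; last exact: pc_eq_comm.
case: a b {H} => x i [y j] /= <-; have [->|] := eqVneq i j; first exact: comm_refl.
move=> ij; have -> : (x, j) = inv_letter (x, i) by rewrite /inv_letter /=; case: i j ij => [] [].
rewrite /comm; transitivity ([::] : W); first exact: pc_eq_cancel.
symmetry; rewrite -{2}(inv_letterK (x, i)); exact: pc_eq_cancel.
Qed.

(** * Supports and the retraction onto [G(A)] *)

Definition over A w := all (fun a : letter X => a.1 \in A) w.

Lemma over_sub A w w' : {subset w' <= w} -> over A w -> over A w'.
Proof. by move=> s /allP H; apply/allP => a /s/H. Qed.

Lemma over_cat A u v : over A (u ++ v) = over A u && over A v.
Proof. exact: all_cat. Qed.

Lemma over_winv A w : over A (winv w) = over A w.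
Proof. by rewrite /over all_rev all_map. Qed.

Lemma over_conj A p u : over A p -> over A u -> over A (conj p u).
Proof. by rewrite !over_cat over_winv => -> ->. Qed.

Lemma mul_sub a w : {subset mul a w <= a :: w}.
Proof.
move=> b; rewrite /mul; case: ifP => // _ /mem_rem; rewrite in_cons => ->; exact: orbT.
Qed.

Lemma nf_sub w : {subset nf w <= w}.
Proof.
elim: w => //= a w IH b /mul_sub; rewrite !in_cons => /orP[->//|/IH ->]; exact: orbT.
Qed.

Lemma mem_pw (T : eqType) (w : seq T) n : {subset pw w n <= w}.
Proof. by move=> a /flattenP[s /nseqP[->]]. Qed.

Definition restrict A w : W := [seq a <- w | a.1 \in A].

Lemma restrict_cat A u v : restrict A (u ++ v) = restrict A u ++ restrict A v.
Proof. exact: filter_cat. Qed.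

Lemma restrict_over A w : over A (restrict A w).
Proof. exact: filter_all. Qed.

Lemma restrict_id A w : over A w -> restrict A w = w.
Proof. by move=> /all_filterP. Qed.

(** Deleting the generators outside [A] maps each defining relation to itself or to a trivial
    one. *)
Lemma restrict_pc_eq A u v : u =G v -> restrict A u =G restrict A v.
Proof.
elim=> {u v} [_ _ []|u|u v _ IH|u v w _ IH1 _ IH2].
- move=> u v a; rewrite !restrict_cat /=; case: ifP => aA; rewrite /= aA; last by reflexivity.
  have /= -> := pc_eq_ctx (restrict A u) (restrict A v) (pc_eq_cancel a); reflexivity.
- move=> u v a b eab; rewrite !restrict_cat /=.
  case: (a.1 \in A); case: (b.1 \in A); try by reflexivity.
  have /= -> := pc_eq_ctx (restrict A u) (restrict A v) (pc_eq_comm eab); reflexivity.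
- by reflexivity.
- by symmetry.
- by transitivity (restrict A v).
Qed.

Lemma restrict_comm A u v : comm u v -> comm (restrict A u) (restrict A v).
Proof. by move=> /(restrict_pc_eq A); rewrite !restrict_cat. Qed.

Lemma proj_restrict A x y w : proj x y (restrict A w) = restrict A (proj x y w).
Proof. by rewrite /proj /restrict -!filter_predI; apply: eq_filter => a /=; rewrite andbC. Qed.

(** * Cyclically reduced elements and their centralisers *)

Lemma proj_neq_nil a y w : has (fun b => b.1 == a.1) w -> proj a.1 y w != [::].
Proof. by move=> H; rewrite -has_filter; apply: sub_has H => b /= ->. Qed.

Lemma cancels_mem a w : cancels a w -> inv_letter a \in w.
Proof. by case/cancels_split => v1 [v2 [-> _]]; rewrite mem_cat mem_head orbT. Qed.

Lemma cancels_cat_inv a u v : cancels a (u ++ v) ->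
  cancels a u \/ all (fun b => e a.1 b.1) u /\ cancels a v.
Proof.
move=> /cancelsP H; case: (boolP (all (fun b => e a.1 b.1) u)) => [au|].
  right; split=> //; apply/cancelsP => y ay.
  by rewrite -(H y ay) proj_cat (@proj_comm0 _ _ a u) ?eqxx.
case/allPn => b bu ab; left.
have hd y : ~~ e a.1 y -> proj a.1 y u != [::] -> ohead (proj a.1 y u) = Some (inv_letter a).
  by move=> ay; rewrite -(H y ay) proj_cat; case: (proj _ _ u).
(* A first letter [inv_letter a] puts the generator of [a] in [u], so no projection used in
   [cancels a u] is empty. *)
have au : has (fun b => b.1 == a.1) u.
  have : proj a.1 b.1 u != [::].
    by rewrite -has_filter; apply/hasP; exists b => //; rewrite eqxx orbT.
  move/(hd _ ab); case E: (proj _ _ u) => [//|c r] /= [Ec]; apply/hasP; exists c; last by rewrite Ec.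
  have : c \in proj a.1 b.1 u by rewrite E mem_head.
  by rewrite mem_filter => /andP[].
by apply/cancelsP => y ay; apply: hd => //; apply: proj_neq_nil.
Qed.

Lemma reduced_cat u v : reduced u -> reduced v ->
  (forall a r s, u = r ++ a :: s -> all (fun b => e a.1 b.1) s -> ~~ cancels a v) ->
  reduced (u ++ v).
Proof.
move=> ru rv H; elim: u ru H => //= a u IH /andP[nau ru] H.
rewrite IH // ?andbT; last by move=> b r s E; apply: (H b (a :: r)); rewrite E.
apply/negP => /cancels_cat_inv[|[au av]]; first by rewrite (negbTE nau).
by move: av; rewrite (negbTE (H a [::] u erefl au)).
Qed.

(** Stated for all powers because their lengths are what is compared later; [reduced_cyc] derives it
    from the usual condition on the letters at both ends. *)
Definition cyclically_reduced c := forall n, reduced (pw c n).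

Lemma reduced_cyc c : reduced c ->
  (forall a r s, c = r ++ a :: s -> all (fun b => e a.1 b.1) s -> ~~ cancels a c) ->
  cyclically_reduced c.
Proof.
move=> rc H; elim=> // n IH; rewrite pwS; apply: reduced_cat => // a r s E as_.
case: n {IH} => [|n]; first by apply/negP => /cancels_mem.
apply/negP; rewrite pwS => /cancels_cat_inv[|[/allP/(_ a)]].
  by rewrite (negbTE (H a r s E as_)).
by rewrite E mem_cat mem_head orbT e_irr => /(_ isT).
Qed.

Lemma size_mul_cancels a w : cancels a w -> size (mul a w) < size w.
Proof.
by move=> ca; rewrite /mul ca (size_rem (cancels_mem ca)); case: w ca => // /cancels_mem.
Qed.

(** Induction on length: if [a] can be moved to the end and [inv_letter a] to the front, conjugating
    by [a] cancels the two and stays in [G(A)]. *)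
Lemma cyc_conj A w : over A w ->
  exists p c, [/\ w =G conj p c, over A p, over A c & cyclically_reduced c].
Proof.
have [n] := ubnP (size w); elim: n w => // n IH w wn wA.
have nA : over A (nf w) := over_sub (@nf_sub w) wA.
have sw : size (nf w) <= size w := len_le w.
have [[a [r [s [E [as_ ca]]]]]|no] := classic (exists a r s, nf w = r ++ a :: s /\
  (all (fun b => e a.1 b.1) s /\ cancels a (nf w))); last first.
  exists [::], (nf w); split=> //; first by rewrite /conj cats0 nf_pc_eq; reflexivity.
  apply: reduced_cyc (reduced_nf _) _ => a r s E as_; apply/negP => ca.
  by apply: no; exists a, r, s.
have wrs : w =G (r ++ s) ++ [:: a].
  by rewrite -(nf_pc_eq w) E (pc_eq_cons_all as_) catA; reflexivity.
have crs : cancels a (r ++ s).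
  apply/cancelsP => y ay; have /cancelsP/(_ y ay) := ca.
  rewrite E !proj_cat proj_cons eqxx /=; case: (proj _ _ r) => //= -[Ea].
  by have := inv_letter_neq a; rewrite -Ea eqxx.
have aA : a.1 \in A by have := allP nA a; rewrite E mem_cat mem_head orbT; apply.
have rsA : over A (r ++ s).
  by apply: over_sub nA => b; rewrite E !mem_cat in_cons => /orP[]->; rewrite ?orbT.
have [||p [c [Ep pA cA cc]]] := IH (mul a (r ++ s)).
- have := size_mul_cancels crs; move: sw wn; rewrite E !size_cat /=; lia.
- by apply: over_sub (@mul_sub a _) _; rewrite /over /= aA.
exists (inv_letter a :: p), c; split=> //; last by rewrite /over /= aA.
rewrite -(conj_conj (winv [:: a])) -Ep mul_pc_eq wrs; symmetry; exact: (conj_rot [:: a]).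
Qed.

Lemma cyc_len c n : cyclically_reduced c -> len (pw c n) = n * size c.
Proof. by move/(_ n); rewrite reduced_len size_pw => /eqP. Qed.

(* [n |c| + |g| - |c ^ n g|] is nondecreasing in [n] and bounded, so for large [n] no cancellation
   happens between [c] and [c ^ n g]. *)
Lemma comm_cyc_teq c g : cyclically_reduced c -> comm c g ->
  exists n h, [/\ h =G pw c n ++ g, teq (c ++ h) (h ++ c) & {subset h <= c ++ g}].
Proof.
move=> cc cg; pose l n := len (pw c n ++ g).
have lS n : l n.+1 <= size c + l n.
  by rewrite /l pwS -catA (leq_trans (len_cat _ _)) // leq_add2r len_le.
have lge n : n * size c <= l n + size g.
  rewrite -cyc_len // -(len_eq (u := (pw c n ++ g) ++ winv g)); last first.
    by rewrite -catA mulwV cats0; reflexivity.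
  by rewrite (leq_trans (len_cat _ _)) // leq_add2l len_winv.
have [n ln] : exists n, l n.+1 = size c + l n.
  apply: NNPP => no; have ub n : l n + n <= n * size c + size g.
    elim: n => [|n IH]; first by rewrite /l addn0 len_le.
    have : l n.+1 <> size c + l n by move=> E; apply: no; exists n.
    have := lS n; lia.
  (* [ub] and [lge] together give [n <= 2 |g|], which this [n] violates. *)
  by have := ub (size g + size g).+1; have := lge (size g + size g).+1; lia.
have hE : nf (pw c n ++ g) =G pw c n ++ g := nf_pc_eq _.
exists n, (nf (pw c n ++ g)); split=> //; last first.
  move=> a /nf_sub; rewrite !mem_cat => /orP[/mem_pw->//|->]; exact: orbT.
have ch : c ++ nf (pw c n ++ g) =G nf (pw c n ++ g) ++ c.
  rewrite hE; apply/comm_sym/comm_cat; last exact: comm_sym.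
  exact/comm_pw/comm_refl.
apply: reduced_teq => //; last by rewrite !size_cat addnC.
rewrite reduced_len size_cat -/(len _) -/(l n) -ln; apply/eqP/len_eq.
by rewrite hE catA -pwS; reflexivity.
Qed.

(** Reduces an inclusion of centralisers to free monoids. With [h = u ^ n s] commuting with [u]
    without cancellation, the hypothesis makes [v] commute with [h] and, applied to the projections
    of [u], with [u]; hence with [s]. *)
Lemma comm_proj u v s : cyclically_reduced u ->
  (forall x y h, ~~ e x y -> h ++ proj x y u = proj x y u ++ h ->
     h ++ proj x y v = proj x y v ++ h) ->
  comm u s -> comm v s.
Proof.
move=> cu H us; have [n [h [hE uh _]]] := comm_cyc_teq cu us.
have vh : comm h v.
  apply: teq_pc_eq => x y exy; rewrite !proj_cat H // -!proj_cat; symmetry; exact: uh.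
have vu : comm u v.
  by apply: teq_pc_eq => x y exy; rewrite !proj_cat H.
rewrite hE in vh; apply: comm_sym; apply: comm_catK vh _; exact: comm_pw.
Qed.

Lemma over_setT w : over setT w.
Proof. by apply/allP => a _; rewrite inE. Qed.

(** After conjugation [g] is cyclically reduced, and so are its powers; [comm_proj] then leaves
    [cat_comm_root]. *)
Lemma comm_root g t (p : nat) : 0 < p -> comm (pw g p) t -> comm g t.
Proof.
move=> p0; have [q [c [gE _ _ cc]]] := cyc_conj (over_setT g).
rewrite (pw_pc_eq p gE) conj_pw gE !comm_conj; apply: comm_proj.
  by move=> n; rewrite pwM.
by move=> x y h exy; rewrite /proj filter_pw; apply: cat_comm_root.
Qed.

Lemma comm_pwE g t (p : nat) : 0 < p -> comm (pw g p) t <-> comm g t.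
Proof. by move=> p0; split; [apply: comm_root | apply: comm_pw]. Qed.

(** * Products of commuting parabolic subgroups *)

Section Product.
Variables B B' : {set X}.
Hypothesis BB' : forall x y, x \in B -> y \in B' -> e x y.

Lemma over_comm u v : over B u -> over B' v -> comm u v.
Proof.
move=> /allP uB /allP vB; apply: comm_adj => a b /uB aB /vB bB.
by rewrite /adj BB' ?orbT.
Qed.

Lemma restrict_disjoint v : over B' v -> restrict B v = [::].
Proof.
move=> /allP vB; apply/eqP; rewrite -(negbK (_ == _)) -has_filter; apply/hasPn => a /vB aB'.
by apply/negP => aB; have := BB' aB aB'; rewrite e_irr.
Qed.

Lemma size_restrict w : size (restrict B w) + size (restrict B' w) <= size w.
Proof.
rewrite !size_filter -count_predUI [X in _ + X <= _](_ : _ = 0) ?addn0 ?count_size //.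
apply/eqP; rewrite -leqn0 leqNgt -has_count; apply/hasPn => a _ /=.
by apply/negP => /andP[aB aB']; have := BB' aB aB'; rewrite e_irr.
Qed.

Lemma proj_disjoint x y u v : ~~ e x y -> over B u -> over B' v ->
  proj x y u = [::] \/ proj x y v = [::].
Proof.
move=> exy /allP uB /allP vB.
case Eu: (proj x y u) => [|a r]; first by left.
case Ev: (proj x y v) => [|b s]; first by right.
have : a \in proj x y u by rewrite Eu mem_head.
have : b \in proj x y v by rewrite Ev mem_head.
rewrite !mem_filter => /andP[bxy /vB bB] /andP[axy /uB aB].
have := BB' aB bB; move: bxy axy exy.
by move=> /orP[]/eqP-> /orP[]/eqP->; rewrite ?e_irr // => /negbTE; rewrite ?(e_sym y) => ->.
Qed.

End Product.

(** A shorter form of [(c d) ^ n = c ^ n d ^ n] would retract to [B] or [B'] as a word shorter than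
    the reduced [c ^ n] or [d ^ n]. *)
Lemma cyc_cat B B' c d : (forall x y, x \in B -> y \in B' -> e x y) ->
  over B c -> over B' d -> cyclically_reduced c -> cyclically_reduced d -> cyclically_reduced (c ++ d).
Proof.
move=> BB' cB dB cc cd n.
have B'B x y : x \in B' -> y \in B -> e x y by move=> xB yB; rewrite e_sym BB'.
have cdn : nf (pw (c ++ d) n) =G pw c n ++ pw d n.
  rewrite nf_pc_eq; exact: pw_cat n (over_comm BB' cB dB).
have pB : over B (pw c n) := over_sub (@mem_pw _ c n) cB.
have pB' : over B' (pw d n) := over_sub (@mem_pw _ d n) dB.
rewrite reduced_len eqn_leq len_le /= (leq_trans _ (size_restrict BB' _)) //.
rewrite size_pw size_cat mulnDr -!size_pw leq_add //; apply: len_min => //.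
  rewrite (restrict_pc_eq B cdn).
  by rewrite restrict_cat (restrict_disjoint BB' pB') cats0 restrict_id //; reflexivity.
rewrite (restrict_pc_eq B' cdn).
by rewrite restrict_cat (restrict_disjoint B'B pB) restrict_id //; reflexivity.
Qed.

(** Each factor has its own conjugator to a cyclically reduced word, and the product of the
    conjugators serves both. A projection to a non-edge then sees only one of the two words, so
    [comm_proj] applies. *)
Lemma comm_factor B B' u v s : (forall x y, x \in B -> y \in B' -> e x y) ->
  over B u -> over B' v -> comm (u ++ v) s <-> comm u s /\ comm v s.
Proof.
move=> BB' uB vB; split; last by case; apply: comm_cat.
move=> uvs; suff us : comm u s by split=> //; apply: comm_catK uvs us.
have [p [c [uE pB cB cc]]] := cyc_conj uB.
have [q [d [vE qB dB cd]]] := cyc_conj vB.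
have uE' : u =G conj (p ++ q) c.
  by rewrite uE -conj_conj (@conj_id q c) //; [reflexivity | apply/comm_sym/(over_comm BB')].
have vE' : v =G conj (p ++ q) d.
  by rewrite -conj_conj -vE conj_id //; [reflexivity | apply: over_comm pB vB].
move: uvs; rewrite {1}uE' vE' -conj_cat uE' !comm_conj.
apply: comm_proj; first exact: cyc_cat cB dB cc cd.
move=> x y h exy; rewrite proj_cat.
by case: (proj_disjoint BB' exy cB dB) => ->; rewrite ?cats0.
Qed.

Lemma over_split B B' w : (forall x y, x \in B -> y \in B' -> e x y) ->
  over (B :|: B') w -> w =G restrict B w ++ restrict B' w.
Proof.
move=> BB'; elim: w => [|a w IH] /=; first by reflexivity.
rewrite inE => /andP[aBB /IH {}IH].
have nBB' : a.1 \in B -> a.1 \in B' -> False by move=> h1 h2; have := BB' _ _ h1 h2; rewrite e_irr.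
transitivity ([:: a] ++ restrict B w ++ restrict B' w); first by rewrite -IH; reflexivity.
case/orP: aBB => aB.
  by rewrite aB; case: ifP => [/(nBB' aB)//|_]; reflexivity.
rewrite aB; case: ifP => [/nBB'/(_ aB)//|_].
have /comm_sym : comm (restrict B w) [:: a].
  by apply: (over_comm BB'); rewrite ?restrict_over //= /over /= aB.
rewrite catA => ->; rewrite -catA; reflexivity.
Qed.

Lemma comm_catKr u v s : comm (u ++ v) s -> comm v s -> comm u s.
Proof.
move=> uvs vs; have -> : u =G (u ++ v) ++ winv v by rewrite -catA mulwV cats0; reflexivity.
by apply: comm_cat => //; apply: comm_winv.
Qed.

(** * Letter counts, components and the splitting of centralisers *)

Definition cnt x w := count (fun a : letter X => a.1 == x) w.

Lemma count_gen (F : pred X) w :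
  count (fun a : letter X => F a.1) w = \sum_(z | F z) cnt z w.
Proof.
elim: w => [|a w IH] /=; first by rewrite big1.
rewrite big_split /= -IH; congr (_ + _); case: (boolP (F a.1)) => Fa.
  by rewrite (bigD1 a.1) //= eqxx big1 // => z /andP[_ /negbTE]; rewrite eq_sym => ->.
by rewrite big1 // => z Fz; case: eqP => // E; rewrite E Fz in Fa.
Qed.

Lemma cnt_proj x y w : cnt x (proj x y w) = cnt x w.
Proof.
rewrite /cnt /proj count_filter; apply: eq_count => a /=.
by case: eqP => // ->.
Qed.

Lemma cnt_projr x y w : cnt y (proj x y w) = cnt y w.
Proof. by rewrite projC cnt_proj. Qed.

Lemma cnt_pw x w n : cnt x (pw w n) = n * cnt x w.
Proof. by elim: n => // n IH; rewrite pwS [LHS]count_cat -!/(cnt x _) IH mulSn. Qed.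

(** The projections commute, so their powers of equal length agree; [x] and [y] are counted in
    these. *)
Lemma cnt_ratio c h x y : teq (c ++ h) (h ++ c) -> ~~ e x y -> 0 < cnt x c ->
  cnt x h * cnt y c = cnt y h * cnt x c.
Proof.
move=> ch exy x0; have E := ch x y exy; rewrite !proj_cat in E.
have Em := cat_comm_pw_eq E (mulnC _ _).
have n0 : 0 < size (proj x y c).
  by rewrite (leq_trans x0) // -(cnt_proj x y) count_size.
have := congr1 (cnt x) Em; rewrite !cnt_pw !cnt_proj => Ex.
have := congr1 (cnt y) Em; rewrite !cnt_pw !cnt_projr => Ey.
by apply/eqP; rewrite -(eqn_pmul2l n0) !mulnA -Ex -Ey mulnAC.
Qed.

Lemma teq_comm_mem c h a b : teq (c ++ h) (h ++ c) ->
  a \in h -> b \in c -> ~~ e a.1 b.1 -> a \in c.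
Proof.
move=> ch ah bc ab; have := ch _ _ ab; rewrite !proj_cat => /esym/cat_comm_mem H.
have : a \in proj a.1 b.1 c.
  apply: H; last by rewrite mem_filter eqxx.
  by rewrite -has_filter; apply/hasP; exists b; rewrite // eqxx orbT.
by rewrite mem_filter => /andP[].
Qed.

Definition gens w : {set X} := [set x | has (fun a : letter X => a.1 == x) w].

Lemma gensP x w : reflect (exists2 a, a \in w & a.1 = x) (x \in gens w).
Proof.
rewrite inE; apply: (iffP hasP) => -[a aw]; first by move/eqP; exists a.
by move=> <-; exists a.
Qed.

Lemma mem_gens a w : a \in w -> a.1 \in gens w.
Proof. by move=> aw; apply/gensP; exists a. Qed.

Lemma cnt_gens x w : (x \in gens w) = (0 < cnt x w).
Proof. by rewrite inE has_count. Qed.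

(** Cancelling powers of [c] makes [u ^ k] a positive, zero or negative power of [c], and nonzero
    powers keep the centraliser by [comm_pwE]. The sign is treated by cases, as [pw] has natural
    exponents. *)
Lemma pw_comm_dichotomy c u m n k : 0 < k -> comm c u ->
  pw c n ++ pw u k =G pw c m ->
  (forall t, comm u t <-> comm c t) \/ (forall t, comm u t).
Proof.
move=> k0 cu; have [nm E|mn E] := leqP n m.
  have {}E : pw u k =G pw c (m - n).
    by apply: (@mulw_inj (pw c n)); rewrite -pwD subnKC.
  have [m0|m0] := posnP (m - n).
    right=> t; rewrite -(@comm_pwE u t k) // E m0; exact: comm_nil.
  by left=> t; rewrite -(@comm_pwE u t k) // E comm_pwE.
have {}E : pw c (n - m) ++ pw u k =G [::].
  apply: (@mulw_inj (pw c m)); rewrite catA -pwD subnKC ?E ?cats0; [reflexivity|exact: ltnW].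
have m0 : 0 < n - m by rewrite subn_gt0.
left=> t; rewrite -(@comm_pwE u t k) // -(@comm_pwE c t (n - m)) //.
have Et : comm (pw c (n - m) ++ pw u k) t by rewrite E; exact: comm_nil.
split=> [ut|ct]; last exact: comm_catK Et ct.
exact: comm_catKr Et ut.
Qed.

(* Connected component of [x] in the non-commutation graph on the support of [c]. *)
Definition comp c x : {set X} :=
  [set y | connect [rel y z | [&& y \in gens c, z \in gens c & ~~ e y z]] x y].

Lemma comp_ind c x (P : X -> Prop) : P x ->
  (forall y z, y \in gens c -> z \in gens c -> ~~ e y z -> P y -> P z) ->
  forall y, y \in comp c x -> P y.
Proof.
move=> Px H y; rewrite inE => /connectP[p + ->]; elim: p x Px => //= z p IH x Px.
by case/andP=> /and3P[xc zc xz]; apply: (IH z); apply: H xz Px.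
Qed.

Lemma comp_gens c x y : x \in gens c -> y \in comp c x -> y \in gens c.
Proof. by move=> xc; apply: (@comp_ind c x (fun y => y \in gens c)). Qed.

Lemma comp_refl c x : x \in comp c x.
Proof. by rewrite inE connect0. Qed.

Lemma comp_step c x y z : y \in comp c x -> y \in gens c -> z \in gens c ->
  ~~ e y z -> z \in comp c x.
Proof.
rewrite !inE => xy yc zc yz; apply: connect_trans xy (connect1 _).
by rewrite /= !inE yc zc.
Qed.

(* Projections to pairs of non-commuting generators make the letter counts of [c] and [h]
   proportional along the component, so suitable powers have commuting projections of equal
   length. *)
Lemma comp_root c h x : teq (c ++ h) (h ++ c) -> x \in gens c ->
  pw (restrict (comp c x) h) (cnt x c) =G pw (restrict (comp c x) c) (cnt x h).
Proof.
set B := comp c x => ch xc.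
have ratio y : y \in B -> cnt x c * cnt y h = cnt x h * cnt y c.
  apply: (@comp_ind c x (fun y => _ * cnt y h = _ * cnt y c)) => [|{}y z yc zc yz IH].
    by rewrite mulnC.
  rewrite cnt_gens in yc.
  have := cnt_ratio ch yz yc => E.
  by apply/eqP; rewrite -(eqn_pmul2l yc); apply/eqP; nia.
apply: teq_pc_eq => y z yz; rewrite /proj !filter_pw; apply: cat_comm_pw_eq.
  by have := ch y z yz; rewrite -![[seq a <- _ | _]]/(proj y z _) !proj_restrict -!restrict_cat !proj_cat => ->.
pose F : pred X := fun x' => (x' \in B) && ((x' == y) || (x' == z)).
have sz w : size [seq a <- restrict B w | (a.1 == y) || (a.1 == z)] = \sum_(x' | F x') cnt x' w.
  by rewrite -count_gen /restrict -filter_predI size_filter; apply: eq_count => a /=; rewrite /F andbC.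
by rewrite !sz !big_distrr; apply: eq_bigr => x' /andP[/ratio].
Qed.

Definition link A B : {set X} := [set z in A | [forall y in B, e y z]].

Lemma linkP A B y z : y \in B -> z \in link A B -> e y z.
Proof. by move=> yB; rewrite inE => /andP[_ /forall_inP]; apply. Qed.

(** Write [u = c ^ -n h] with [h] commuting with [c] without cancellation. A letter of [h] that
    fails to commute with some letter of [c] occurs in [c], and letters of [c] outside the component
    commute with it; hence the splitting. On the component, a positive power of [h] is a power of
    [c]. *)
Lemma comm_comp_split A c x u :
  over A c -> over A u -> cyclically_reduced c -> x \in gens c -> comm c u ->
  let B := comp c x in
  u =G restrict B u ++ restrict (link A B) u /\
  ((forall t, comm (restrict B u) t <-> comm (restrict B c) t) \/
   (forall t, comm (restrict B u) t)).
Proof.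
move=> cA uA cc xc cu B; have [n [h [hE ch hs]]] := comm_cyc_teq cc cu.
have BB' : forall y z, y \in B -> z \in link A B -> e y z := @linkP A B.
have sub w : (forall a b, a \in w -> b \in c -> ~~ e b.1 a.1 -> a \in c) -> over A w ->
    over (B :|: link A B) w.
  move=> H wA; apply/allP => a aw; rewrite !inE (allP wA) //=.
  case: (boolP (a.1 \in B)) => [|aB]; first by rewrite inE => ->.
  apply/orP; right; apply/forall_inP => y yB; apply/negPn/negP => ya.
  have /gensP[b bc Eb] := comp_gens xc yB; rewrite -Eb in ya.
  have ac := H a b aw bc ya; move/negP: aB; apply.
  by apply: comp_step yB _ (mem_gens ac) _; rewrite -Eb ?mem_gens.
have cB : over (B :|: link A B) c by apply: sub.
have hB : over (B :|: link A B) h.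
  apply: sub => [a b ah bc ba|]; first by apply: teq_comm_mem ch ah bc _; rewrite e_sym.
  by apply: over_sub hs _; rewrite over_cat cA.
have uE : u =G winv (pw c n) ++ h by rewrite hE mulKw; reflexivity.
split.
  have := restrict_pc_eq (link A B) uE; have := restrict_pc_eq B uE => -> ->.
  rewrite {1}uE; apply: over_split => //; rewrite over_cat over_winv hB andbT.
  exact: over_sub (@mem_pw _ c n) cB.
have c0 : 0 < cnt x c by rewrite -cnt_gens.
(* The relation is [h = c ^ n u] restricted to [B] and raised to [cnt x c], the exponent of [h] in
   [comp_root]. *)
apply: (@pw_comm_dichotomy _ _ (cnt x h) (cnt x c * n) (cnt x c)) => //.
  exact: restrict_comm.
rewrite -comp_root // -pwM -pw_cat; last by apply/comm_pw/restrict_comm.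
apply: pw_pc_eq; have := restrict_pc_eq B hE; rewrite restrict_cat => ->.
by rewrite /restrict filter_pw; reflexivity.
Qed.

(** * Patterns and the reduction step *)

Definition star y : {set X} := [set x | adj x y].

(** The combinatorial form of a canonical chain: generators [x_i] in [A] and [y_i] in [X], [i < k],
    with [x_i] commuting with [y_j] for [j < i] but not with [y_i]. The greatest such [k] is the
    height of [A]. *)
Fixpoint has_pattern A k : bool :=
  if k is k'.+1 then [exists x in A, [exists y, ~~ adj x y && has_pattern (A :&: star y) k']]
  else true.

Lemma has_patternS A x y k : x \in A -> ~~ adj x y -> has_pattern (A :&: star y) k ->
  has_pattern A k.+1.
Proof.
by move=> xA xy H /=; apply/existsP; exists x; rewrite xA; apply/existsP; exists y; rewrite xy.
Qed.

Lemma has_pattern_le A j k : j <= k -> has_pattern A k -> has_pattern A j.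
Proof.
elim: k A j => [|k IH] A [|j] //= jk /existsP[x /andP[xA /existsP[y /andP[xy H]]]].
exact: has_patternS xA xy (IH _ _ jk H).
Qed.

Lemma has_pattern_sub A A' k : A \subset A' -> has_pattern A k -> has_pattern A' k.
Proof.
elim: k A A' => //= k IH A A' AA' /existsP[x /andP[xA /existsP[y /andP[xy H]]]].
by apply: has_patternS (subsetP AA' x xA) xy (IH _ _ _ H); apply: setSI.
Qed.

Lemma has_pattern_card A k : has_pattern A k -> k <= #|A|.
Proof.
elim: k A => //= k IH A /existsP[x /andP[xA /existsP[y /andP[xy /IH H]]]].
apply: leq_ltn_trans H _; apply/proper_card/properP; split; first exact: subsetIl.
by exists x; rewrite // !inE (negbTE xy) andbF.
Qed.

(* [Q] is to be the centraliser of one element; [p], [A], [Ds] are shared by all the elements that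
   remain in the chain. *)
Definition decomposable p A (Ds : list (W -> Prop)) (Q : W -> Prop) :=
  exists J u, [/\ List.incl J Ds, over A u &
    forall t, Q t <-> (forall D, List.In D J -> D t) /\ comm (conj p u) t].

(** Passing to the elements of [G(A)] that commute with [s] lowers the height by more than the
    number of predicates introduced. *)
Definition reducible A s := exists p A' Ds,
  (forall m, has_pattern A' m -> has_pattern A (m + (List.length Ds).+1)) /\
  (forall u, over A u -> comm u s -> decomposable p A' Ds (comm u)).

Definition conj_pred p (D : W -> Prop) : W -> Prop := fun t => D (conj (winv p) t).

Lemma decomposable_conj p q A Ds Q : decomposable q A Ds Q ->
  decomposable (p ++ q) A (List.map (conj_pred p) Ds) (conj_pred p Q).
Proof.
case=> J [u [JD uA H]]; exists (List.map (conj_pred p) J), u; split=> //.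
  by move=> D /List.in_map_iff[D' [<- /JD]]; apply: List.in_map.
move=> t; have E : comm (conj (p ++ q) u) t <-> comm (conj q u) (conj (winv p) t).
  by rewrite -conj_conj; apply: comm_conj.
rewrite /conj_pred H E; split=> -[HJ Hc]; split=> //.
  by move=> D /List.in_map_iff[D' [<- /HJ]].
by move=> D DJ; apply: (HJ (conj_pred p D)); apply: List.in_map.
Qed.

Lemma decomposable_iff p A Ds Q Q' : (forall t, Q t <-> Q' t) -> decomposable p A Ds Q -> decomposable p A Ds Q'.
Proof. by move=> QQ' [J [u [? ? H]]]; exists J, u; split=> // t; rewrite -QQ'. Qed.

Lemma decomposable_comm A u v : u =G v -> over A v -> decomposable [::] A nil (comm u).
Proof.
move=> uv vA; exists nil, v; split=> // t; rewrite /conj cats0 uv.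
by split=> [|[]].
Qed.

Lemma reducible_conj A p s : over A p -> reducible A (conj (winv p) s) -> reducible A s.
Proof.
move=> pA [q [A' [Ds [HA H]]]]; exists (p ++ q), A', (List.map (conj_pred p) Ds).
split=> [m|u uA us]; first by rewrite List.length_map; apply: HA.
have vA : over A (conj (winv p) u) by rewrite over_conj ?over_winv.
have := decomposable_conj p (H _ vA (conj_comm _ us)); apply: decomposable_iff => t.
rewrite /conj_pred; split=> [/(conj_comm p)|]; last exact: conj_comm.
by rewrite !conjKV.
Qed.

Lemma reducible_imp A s s' : (forall u, over A u -> comm u s -> comm u s') ->
  reducible A s' -> reducible A s.
Proof.
by move=> H [p [A' [Ds [? H']]]]; exists p, A', Ds; split=> // u uA us; apply/H'/H.
Qed.

Lemma reducible_star A s x y : x \in A -> ~~ adj x y ->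
  (forall u, over A u -> comm u s -> exists2 v, u =G v & over (A :&: star y) v) ->
  reducible A s.
Proof.
move=> xA xy H; exists [::], (A :&: star y), nil; split=> [m|u uA us].
  by rewrite /= addn1; apply: has_patternS xA xy.
have [v uv vA] := H u uA us; exact: decomposable_comm uv vA.
Qed.

(** If two generators of [c] fail to commute, the variable part of [u] is confined to the link of a
    component, at the price of one fixed centraliser. Otherwise [reducible_star] applies. *)
Lemma reducible_cyc A c : over A c -> cyclically_reduced c ->
  (exists2 y, y \in A & exists2 z, z \in gens c & ~~ adj y z) ->
  reducible A c.
Proof.
move=> cA cc [y yA [z zc yz]].
have [[x1 [x2 [x1c x2c x12]]]|no] := classic (exists x1 x2, [/\ x1 \in gens c, x2 \in gens c & ~~ adj x1 x2]).
  have gA (o : X) : o \in gens c -> o \in A by case/gensP => b bc <-; apply: (allP cA).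
  have ne : ~~ e x1 x2 by move: x12; rewrite negb_or => /andP[].
  have x2B : x2 \in comp c x1 by apply: comp_step (comp_refl _ _) x1c x2c ne.
  exists [::], (link A (comp c x1)), [:: comm (restrict (comp c x1) c)]; split=> [m Hm|u uA uc].
    (* The two extra pattern steps are [x1] against [x2], then [x2] against [x1]; the link commutes
       with both. *)
    rewrite [m + _]addn2; apply: (has_patternS (gA _ x1c) x12).
    apply: (@has_patternS _ x2 x1); rewrite 1?adj_sym // ?inE ?gA //.
      by rewrite /adj eqxx.
    apply: has_pattern_sub Hm; apply/subsetP => a aL.
    have ea (o : X) : o \in comp c x1 -> adj a o.
      by move=> /linkP/(_ aL) ba; rewrite adj_sym /adj ba orbT.
    rewrite !inE !ea ?comp_refl // !andbT; move: aL; rewrite inE => /andP[->//].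
  have /= [uE D] := comm_comp_split cA uA cc x1c (comm_sym uc).
  set B := comp c x1 in uE D *.
  have fact t : comm u t <-> comm (restrict B u) t /\ comm (restrict (link A B) u) t.
    by rewrite {1}uE; apply: (comm_factor _ (@linkP A B)); apply: restrict_over.
  case: D => D.
    exists [:: comm (restrict B c)], (restrict (link A B) u); split=> //; first exact: restrict_over.
    move=> t; rewrite fact D /conj cats0; split=> -[H1 H2]; split=> //; first by move=> E [<-|[]].
    by apply: H1; left.
  exists nil, (restrict (link A B) u); split=> //; first exact: restrict_over.
  by move=> t; rewrite fact /conj cats0; split=> -[].
(* Now the generators of [c] commute pairwise. A letter of [h] not commuting with [z] would be a
   letter of [c], hence commute with [z]. *)
apply: (reducible_star yA yz) => u uA /comm_sym cu.
have [n [h [hE ch hs]]] := comm_cyc_teq cc cu.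
have cadj o o' : o \in gens c -> o' \in gens c -> adj o o'.
  by move=> oc oc'; apply/negPn/negP => oo'; apply: no; exists o, o'.
exists (winv (pw c n) ++ h); first by rewrite hE mulKw; reflexivity.
have /gensP[b bc bz] := zc.
rewrite over_cat over_winv; apply/andP; split.
  apply/allP => a /mem_pw ac; rewrite !inE (allP cA) //=; apply: cadj => //; exact: mem_gens.
apply/allP => a ah; rewrite !inE.
have -> : a.1 \in A by apply: (allP (over_sub hs _) a ah); rewrite over_cat cA.
rewrite /= -bz; apply/negPn/negP => ab.
have /(teq_comm_mem ch ah bc) ac : ~~ e a.1 b.1 by move: ab; rewrite negb_or => /andP[].
by rewrite cadj ?mem_gens in ab.
Qed.

Lemma reducible_parabolic A c : over A c -> (exists2 u, over A u & ~ comm u c) -> reducible A c.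
Proof.
move=> cA [u uA uc]; have [p [d [cE pA dA cd]]] := cyc_conj cA.
apply: (reducible_conj pA); apply: (@reducible_imp _ _ d).
  by move=> v _; rewrite cE conjVK.
apply: reducible_cyc => //; apply: NNPP => no; apply: uc.
rewrite cE; apply: comm_sym; rewrite comm_conj; apply: comm_sym; apply: comm_adj => a b au bd.
apply/negPn/negP => ab; apply: no; exists a.1; last by exists b.1; rewrite ?mem_gens.
have vA : over A (conj (winv p) u) by apply: over_conj; rewrite ?over_winv.
exact: (allP vA).
Qed.

(** * Minimal double coset representatives and the descent along a chain *)

Definition double_min A t := forall p t' q, over A p -> over A q ->
  t =G p ++ t' ++ q -> size t <= size t'.

Lemma double_min_ex A s : exists p t q,
  [/\ s =G p ++ t ++ q, over A p, over A q & double_min A t].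
Proof.
have [n] := ubnP (size s); suff: size s < n -> exists p t q,
  [/\ s =G p ++ t ++ q, over A p, over A q & double_min A t] by [].
elim: n s => // n IH s sn.
have [dm|] := classic (double_min A s).
  by exists [::], s, [::]; split; rewrite //= cats0; reflexivity.
move=> /not_all_ex_not[p] /not_all_ex_not[t'] /not_all_ex_not[q] H.
have [pA [qA [sE lt]]] : over A p /\ over A q /\ s =G p ++ t' ++ q /\ size t' < size s.
  by apply: NNPP => no; apply: H => pA qA sE; rewrite leqNgt; apply/negP => lt; apply: no.
have [|p' [t [q' [tE p'A q'A dm]]]] := IH t'; first lia.
exists (p ++ p'), t, (q' ++ q); rewrite !over_cat pA p'A q'A; split=> //.
by rewrite sE tE -!catA; reflexivity.
Qed.

Lemma double_min_reduced A t : double_min A t -> reduced t.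
Proof.
move=> dm; rewrite reduced_len eqn_leq len_le; apply: (dm [::] (nf t) [::]) => //.
by rewrite /= cats0 nf_pc_eq; reflexivity.
Qed.

Lemma double_min_front A t a : double_min A t -> a.1 \in A -> ~~ cancels a t.
Proof.
move=> dm aA; apply/negP => ca; have := size_mul_cancels ca.
rewrite ltnNge => /negP; apply; apply: (dm [:: inv_letter a] _ [::]) => //; first by rewrite /over /= aA.
rewrite cats0 mul_pc_eq; have := pc_eq_cancel (inv_letter a); rewrite inv_letterK => H.
by have := pc_eq_ctx [::] t H => /= ->; reflexivity.
Qed.

Lemma double_min_catl A t u : double_min A t -> over A u -> reduced u -> reduced (u ++ t).
Proof.
move=> dm uA ru; apply: reduced_cat => //; first exact: double_min_reduced dm.
move=> a r s E _; apply: (double_min_front dm).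
by apply: (allP uA a); rewrite E mem_cat mem_head orbT.
Qed.

Lemma double_min_catr A t u : double_min A t -> over A u -> reduced u -> reduced (t ++ u).
Proof.
move=> dm uA ru; apply: reduced_cat => //; first exact: double_min_reduced dm.
move=> a r s E as_; apply/negP => /cancels_mem/(allP uA) /= aA.
have /= : size t <= size (r ++ s).
  apply: (dm [::] _ [:: a]) => //; first by rewrite /over /= aA.
  by rewrite E (pc_eq_cons_all as_) -catA; reflexivity.
by rewrite E !size_cat /= addnS ltnn.
Qed.

(* [G(A) ∩ t G(A) t^-1 = G(A ∩ supp(t)^⊥)] for [t] of minimal length in [G(A) t G(A)]. *)
Lemma double_min_conj A t u v : double_min A t -> over A u -> reduced u -> over A v ->
  u ++ t =G t ++ v -> forall a b, a \in u -> b \in t -> e a.1 b.1.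
Proof.
move=> dm; elim: u v => // a u IH v uA ru vA uv.
have vA' : over A (nf v) := over_sub (@nf_sub v) vA.
have uv' : (a :: u) ++ t =G t ++ nf v by rewrite nf_pc_eq.
have rl := double_min_catl dm uA ru.
have rr := double_min_catr dm vA' (reduced_nf v).
have vu' : t ++ nf v =G (a :: u) ++ t by symmetry.
have te := reduced_teq rl uv' (len_min rr vu').
have aA : a.1 \in A by case/andP: uA.
(* The letter [a] can be moved to the front of [t ++ nf v]. By minimality it does not come from [t],
   so it passes all of [t]. *)
have : cancels (inv_letter a) (t ++ nf v).
  rewrite -(cancels_teq _ te).
  by have := @cancels_cat (inv_letter a) [::] (u ++ t) isT; rewrite inv_letterK.
case/cancels_cat_inv => [|[at_ _]].
  have /negbTE -> // := double_min_front (a := inv_letter a) dm aA.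
move=> a' b; rewrite in_cons => /orP[/eqP-> bt|a'u]; first exact: (allP at_ b bt).
(* As [a] commutes with [t], cancelling it on the left turns [v] into [inv_letter a :: v]. *)
apply: (IH (inv_letter a :: v)) a'u.
- by case/andP: uA.
- by case/andP: ru.
- by rewrite /over /= aA.
have ta : comm t [:: inv_letter a].
  apply: comm_sym; apply: comm_letters => x y; rewrite inE => /eqP-> yt.
  exact/pc_eq_comm/(allP at_ y yt).
have E : inv_letter a :: v = [:: inv_letter a] ++ v by [].
rewrite E catA ta -catA -uv; have := pc_eq_cancel (inv_letter a); rewrite inv_letterK => H.
by have := pc_eq_ctx [::] (u ++ t) H => /= ->; reflexivity.
Qed.

(** Up to conjugation in [G(A)], [s = t c] with [t] minimal in its double coset and [c] in [G(A)].
    Commuting with [s] means [u t = t (c u c ^ -1)], so by [double_min_conj] the support of [u]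
    commutes with that of [t]. If all of [A] does, [t] centralises [G(A)] and only [c] matters. *)
Lemma noncentral_reducible A s : (exists2 u, over A u & ~ comm u s) -> reducible A s.
Proof.
case=> u0 u0A u0s; have [p [t [q [sE pA qA dm]]]] := double_min_ex A s.
apply: (reducible_conj pA).
have sE' : conj (winv p) s =G t ++ (q ++ p).
  by rewrite sE conj_rot -catA; reflexivity.
have cA : over A (q ++ p) by rewrite over_cat qA.
move: (q ++ p) sE' cA => c sE' cA.
have [[x [b [xA bt xb]]]|no] := classic (exists x b, [/\ x \in A, b \in t & ~~ adj x b.1]).
  apply: (reducible_star xA xb) => u uA; rewrite sE' => us.
  exists (nf u); first by rewrite nf_pc_eq; reflexivity.
  have nA := over_sub (@nf_sub u) uA.
  apply/allP => a an; rewrite !inE (allP nA) //=; rewrite /adj.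
  rewrite (double_min_conj dm nA (reduced_nf u) (over_conj cA uA) _ an bt) ?orbT //.
  have E : t ++ conj c u = ((t ++ c) ++ u) ++ winv c by rewrite /conj -!catA.
  by rewrite nf_pc_eq E -us -!catA mulwV cats0; reflexivity.
have tA u : over A u -> comm u t.
  move=> uA; apply: comm_adj => a b au bt; apply/negPn/negP => ab; apply: no.
  by exists a.1, b; split=> //; apply: (allP uA).
apply: (@reducible_imp _ _ c).
  by move=> u uA; rewrite sE' => /comm_sym us; apply/comm_sym/(comm_catK us)/comm_sym/tA.
apply: reducible_parabolic => //; exists (conj (winv p) u0); first by rewrite over_conj ?over_winv.
move=> H; apply: u0s; rewrite -(conjKV p u0) comm_conj sE'.
apply: comm_sym; apply: comm_cat; apply: comm_sym => //; apply: tA.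
by rewrite over_conj ?over_winv.
Qed.

(* [List.length Ds] plus the pattern height of [A] bounds the number of steps left; centralising
   one more element lowers it strictly. *)
Lemma pattern_of_chain k p A Ds (T : nat -> W -> Prop) :
  (forall i, i < k -> exists Q, [/\ decomposable p A Ds Q,
     forall j s, j < i -> T j s -> Q s & exists2 s, T i s & ~ Q s]) ->
  has_pattern A (k - List.length Ds).
Proof.
elim: k p A Ds T => // k IH p A Ds T H.
have [Q0 [[J0 [u0 [J0D u0A H0]]] _ [s0 T0 nQ0]]] := H 0 isT.
have T' i : i < k -> exists Q, [/\ decomposable p A Ds Q, Q s0,
    forall j s, j < i -> T j.+1 s -> Q s & exists2 s, T i.+1 s & ~ Q s].
  move=> ik; have [Q [? HQ ?]] := H i.+1 ik; exists Q; split=> //; first exact: (HQ 0).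
  by move=> j s ji; apply: HQ.
have [nc|cen] := classic (exists2 u, over A u & ~ comm u (conj (winv p) s0)).
  have [p' [A' [Ds' [HA red]]]] := noncentral_reducible nc.
  have := IH (p ++ p') A' (List.app Ds (List.map (conj_pred p) Ds')) (fun i => T i.+1).
  rewrite List.length_app List.length_map => {}IH.
  (* The rise from [m] to [m + (List.length Ds').+1] in [HA] pays for [s0] and for the new
     predicates subtracted in [IH]. *)
  apply: has_pattern_le (HA _ (IH _)); first lia.
  move=> i /T'[Q [[J [u [JD uA HQ]]] Qs0 ? ?]]; exists Q; split=> //.
  have us0 : comm u (conj (winv p) s0) by apply/comm_conj; have /HQ[] := Qs0.
  have [J' [u' [JD' u'A HJ']]] := decomposable_conj p (red u uA us0).
  exists (List.app J J'), u'; split=> //; first exact: List.incl_app_app.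
  move=> t; have E : comm (conj p u) t <-> conj_pred p (comm u) t := comm_conj p u t.
  rewrite HQ E HJ'; split=> [[HJ [HJt ?]]|[HJ ?]].
    by split=> // D /List.in_app_iff[/HJ|/HJt].
  by split; [|split=> //] => D DJ; apply: HJ; apply/List.in_app_iff; [left|right].
have [D [DJ nD]] : exists D, List.In D J0 /\ ~ D s0.
  apply: NNPP => no; apply: nQ0; apply/H0; split=> [D DJ|].
    by apply: NNPP => nD; apply: no; exists D.
  by rewrite comm_conj; apply: NNPP => nc; apply: cen; exists u0.
have [l1 [l2 DsE]] := List.in_split _ _ (J0D D DJ).
have := IH p A (List.app l1 l2) (fun i => T i.+1).
rewrite DsE !List.length_app => {}IH; apply: has_pattern_le (IH _); first by simpl; lia.
move=> i /T'[Q [[J [u [JD uA HQ]]] Qs0 ? ?]].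
exists Q; split=> //; exists J, u; split=> // D' D'J; have := JD D' D'J.
rewrite DsE => /List.in_app_iff D'l; apply/List.in_app_iff; case: D'l => [|[E|]]; [by left| |by right].
by case: nD; rewrite E; have /HQ[/(_ D' D'J)] := Qs0.
Qed.

(** * Centraliser chains, patterns and canonical chains *)

Lemma centraliser_chain_pattern k : centraliser_chain e k -> has_pattern setT k.
Proof.
case=> S H; rewrite -(subn0 k).
(* The shift by one: [g] for step [i] lies in [C(S i)] and outside [C(S (i + 1))]. Only the
   centralisers are nested, not the sets, hence [mono]. *)
apply: (@pattern_of_chain k [::] setT nil (fun i => S i.+1)) => i ik.
have [_ [g [gS ngS]]] := H i ik; exists (comm g); split.
- by apply: (@decomposable_comm _ g g); [reflexivity | apply: over_setT].
- have mono n : n <= i -> centraliser e (S n) g.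
    move=> ni; have := subnKC ni; move: (i - n) => m; elim: m n {ni} => [|m IH] n E.
      by rewrite addn0 in E; rewrite E.
    have nk : n < k by apply: leq_ltn_trans ik; rewrite -E leq_addr.
    have [sub _] := H n nk; apply: sub.
    by apply: IH; rewrite -E addnS.
  by move=> j s /mono; apply.
- apply: NNPP => no; apply: ngS => s Ss; apply: NNPP => ns; apply: no; by exists s.
Qed.

Lemma comm_gens x y : comm [:: (x, false)] [:: (y, false)] <-> adj x y.
Proof.
split=> [xy|xy]; last by apply: comm_adj => a b; rewrite !inE => /eqP-> /eqP->.
apply/negPn/negP; rewrite negb_or => /andP[nxy exy].
have rd : reduced [:: (x, false); (y, false)].
  apply/andP; split; last by rewrite /= andbT; apply/negP => /cancels_mem.
  by apply/negP => /cancels_mem; rewrite inE /inv_letter xpair_eqE andbF.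
have := reduced_teq rd xy (leqnn _) exy.
by rewrite /= /proj /= !eqxx orbT => -[E]; rewrite E eqxx in nxy.
Qed.

Lemma pattern_canonical_chain k : has_pattern setT k -> canonical_chain e k.
Proof.
move=> H; have [Y HY] : exists Y : nat -> {set X}, forall i, i < k -> Y i \subset Y i.+1 /\
    exists2 x, x \in [set: X] & (forall y, y \in Y i -> adj x y) /\
      exists2 y, y \in Y i.+1 & ~~ adj x y.
  elim: k [set: X] H => [|k IH] A; first by exists (fun=> set0).
  move=> /existsP[x /andP[xA /existsP[y /andP[xy /IH[Y HY]]]]].
  (* [Y i] collects the first [i] generators [y] of the pattern, so it starts empty; the matching
     [x] separates [C(Y i)] from [C(Y (i + 1))]. *)
  exists (fun i => if i is i'.+1 then y |: Y i' else set0) => -[_|i ik].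
    split; first exact: sub0set.
    by exists x => //; split=> [z|]; [rewrite inE | exists y; rewrite // setU11].
  have [YY [z]] := HY i ik; rewrite !inE => /andP[zA zy] [zY [w wY zw]].
  split; first exact: setUS.
  exists z => //; split; last by exists w => //; rewrite in_setU wY orbT.
  by move=> v; rewrite !inE => /orP[/eqP->|/zY].
exists Y => i /HY[YY [x _ [xY [y yY xy]]]]; split.
  by move=> g Hg s [z zY ->]; apply: Hg; exists z => //; apply: (subsetP YY).
exists [:: (x, false)]; split=> [s [z zY ->]|Hx]; first by apply/comm_gens/xY.
by move/negP: xy; apply; apply/comm_gens/Hx; exists y.
Qed.

Lemma canonical_centraliser_chain k : canonical_chain e k -> centraliser_chain e k.
Proof. by case=> Y H; exists (fun i => gens_of (Y i)). Qed.

End PC.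

Theorem theorem3p3 (X : finType) (e : rel X)
  (e_sym : symmetric e) (e_irr : irreflexive e) :
  exists n : nat, cdim_is e n /\ canonical_height_is e n.
Proof.
have ex : exists k, has_pattern e [set: X] k by exists 0.
have ub k : has_pattern e [set: X] k -> k <= #|[set: X]|.
  exact: has_pattern_card.
(* The height of [X] is the witness: a canonical chain attains it and no centraliser chain exceeds
   it. *)
case: (ex_maxnP ex ub) => n Hn max.
have can := pattern_canonical_chain e_sym e_irr Hn.
have bound m : centraliser_chain e m -> m <= n.
  by move=> /(centraliser_chain_pattern e_sym e_irr)/max.
exists n; split; split=> //; first exact: canonical_centraliser_chain.
by move=> m /canonical_centraliser_chain/bound.
Qed.
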